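(* Let $X$ be a finite-dimensional real Banach space with $\dim X\ge 2$ and let $0<\lambda<1$. If $J_\lambda^\perp(X)=1$, then $S_X$ contains a nontrivial line segment. In particular, $X$ is not strictly convex.
   Context: For a real Banach space $X$, $S_X=\{x\in X:\|x\|=1\}$. For $x,y\in X$, $x\perp_B y$ (Birkhoff--James orthogonality) means $\|x\|\le\|x+ty\|$ for every $t\in\mathbb R$. For $\lambda\in[0,1]$, $$J_\lambda^\perp(X)=\sup\{\min\{\|\lambda x+(1-\lambda)y\|,\|\lambda x-(1-\lambda)y\|\}: x,y\in S_X,\ x\perp_B y\}.$$ A nontrivial line segment is a set $\{tu+(1-t)v:0\le t\le1\}$ with $u\ne v$. *)

(* Defs.v *)
From HB Require Import structures.
From mathcomp Require Import all_boot all_order all_algebra.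
From mathcomp Require Import all_classical all_reals.
From mathcomp Require Import topology normedtype.

Set Implicit Arguments.
Unset Strict Implicit.
Unset Printing Implicit Defensive.

Import Order.TTheory GRing.Theory Num.Theory.
Import numFieldNormedType.Exports.

Local Open Scope classical_set_scope.
Local Open Scope ring_scope.

(* The norm is that of the normed module structure and is otherwise arbitrary;
   the [Vector] structure only records finite dimensionality, so the dimension
   of [X] is [\dim {:X}]. *)
#[short(type="finDimBanachType")]
HB.structure Definition FinDimBanach (R : realType) :=
  {X of Vector R X & CompleteNormedModule R X}.

Definition unit_sphere (R : realType) (X : normedModType R) : set X :=
  [set x | `|x| = 1].
Arguments unit_sphere {R} X _.

Definition BJ_orthogonal (R : realType) (X : normedModType R) (x y : X) : Prop :=
  forall t : R, `|x| <= `|x + t *: y|.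

Definition J_perp (R : realType) (X : normedModType R) (lambda : R) : R :=
  sup [set r | exists x y : X,
    [/\ unit_sphere X x, unit_sphere X y, BJ_orthogonal x y &
        r = Num.min `|lambda *: x + (1 - lambda) *: y|
                    `|lambda *: x - (1 - lambda) *: y|]].

Definition line_segment (R : realType) (X : normedModType R) (u v : X) : set X :=
  [set t *: u + (1 - t) *: v | t in [set t : R | 0 <= t <= 1]].

Definition nontrivial_line_segment (R : realType) (X : normedModType R)
    (A : set X) : Prop :=
  exists u v : X, u <> v /\ A = line_segment u v.

Definition strictly_convex (R : realType) (X : normedModType R) : Prop :=
  forall x y : X, unit_sphere X x -> unit_sphere X y -> x <> y ->
    `|2^-1 *: (x + y)| < 1.

(* Main.v *)
From HB Require Import structures.
Require Import Defs.
From mathcomp Require Import all_boot all_order all_algebra.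
From mathcomp Require Import all_classical all_reals.
From mathcomp Require Import topology normedtype.
From mathcomp Require Import derive.

Import Order.TTheory GRing.Theory Num.Theory.
Import numFieldNormedType.Exports.

Local Open Scope classical_set_scope.
Local Open Scope ring_scope.

(** The supremum defining [J_perp X lambda] ranges over pairs in the product of
    two unit spheres that satisfy a closed condition.  Since [X] is
    finite-dimensional, that set of pairs is compact, so the supremum is
    attained ([J_perp_attained]).  When it equals 1, some unit vectors [x] and
    [y] with [x] Birkhoff-James orthogonal to [y] satisfy
    [1 <= `|lambda *: x + (1 - lambda) *: y|]: the norm, a convex function
    bounded by 1 on the segment from [y] to [x], reaches 1 at an interior point
    of that segment.  It must then be constantly 1 on the segment ([segment_in_sphere]), which
    therefore lies in the unit sphere; in particular its midpoint contradicts
    strict convexity.  Orthogonality is what makes the segment nontrivial, a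
    unit vector not being orthogonal to itself ([BJ_orthogonal_neq]). *)

(** * Compactness of the unit sphere *)

Lemma lincomb_continuous (R : realType) (X : normedModType R) n
    (e : 'I_n -> X) :
  continuous (fun v : 'rV[R]_n => \sum_(i < n) v ord0 i *: e i).
Proof.
move=> v; elim: (index_enum _) => [|i s IHs].
  by under eq_fun do [rewrite big_nil]; apply: cst_continuous.
have -> : (fun u : 'rV[R]_n => \sum_(j <- i :: s) u ord0 j *: e j) =
    (fun u => u ord0 i *: e i) \+ (fun u => \sum_(j <- s) u ord0 j *: e j).
  by apply/funext => u; rewrite big_cons.
apply: (@cvgD _ _ _ (nbhs v)) => //.
by apply: cvgZr_tmp; exact: coord_continuous.
Qed.

(** The minimum of [fun v => `|f v|] on the compact unit sphere of the
    coordinate space is positive by injectivity of [f], and homogeneity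
    propagates the bound to all vectors. *)
Lemma linear_inj_bounded_below (R : realType) (X : normedModType R) n
    (f : {linear 'rV[R]_n -> X}) :
  continuous f -> injective f ->
  exists2 c : R, 0 < c & forall v, c * `|v| <= `|f v|.
Proof.
move=> fcont finj.
have nfcont : continuous (fun v => `|f v|).
  by move=> v; apply: (@cvg_norm _ _ _ (nbhs v)); exact: fcont.
have cS : compact [set v : 'rV[R]_n | `|v| = 1].
  apply: bounded_closed_compact.
    by exists 1; split => // M M1 v /= ->; exact: ltW.
  apply: (@preimage_closed _ _ _ [set x : R | x = 1]); last exact: closed_eq.
  by move=> v _; exact: norm_continuous.
have [S0|S0] := pselect ([set v : 'rV[R]_n | `|v| = 1] !=set0); last first.
  (* with no unit vector, the coordinate space is trivial and any constant does *)
  exists 1 => // v; rewrite mul1r; have [->|v0] := eqVneq v 0.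
    by rewrite !normr0.
  by case: S0; exists (`|v|^-1 *: v); rewrite /= normfZV.
have [c /set_mem /= c1 cmin] :=
  compact_EVT_min S0 cS (continuous_subspaceT nfcont).
exists `|f c|.
  rewrite normr_gt0; apply: contra_eq_neq c1 => fc0.
  by rewrite (finj c 0) ?linear0// normr0 eq_sym oner_eq0.
move=> v; have [->|v0] := eqVneq v 0; first by rewrite normr0 mulr0.
have nv0 : 0 < `|v| by rewrite normr_gt0.
rewrite -ler_pdivlMr//.
have := cmin (`|v|^-1 *: v); rewrite linearZ /= normrZ ger0_norm ?invr_ge0//.
rewrite mulrC; apply.
by rewrite inE /= normrZ ger0_norm ?invr_ge0// mulVf// gt_eqF.
Qed.

Lemma compact_unit_sphere (R : realType) (X : finDimBanachType R) :
  compact (unit_sphere X).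
Proof.
pose n := \dim {:X}.
pose b := vbasis {:X}.
pose f (v : 'rV[R]_n) : X := \sum_(i < n) v ord0 i *: b`_i.
have flin : linear f.
  move=> a u v; rewrite /f scaler_sumr -big_split; apply: eq_bigr => i _ /=.
  by rewrite !mxE scalerDl scalerA.
pose F : {linear 'rV[R]_n -> X} :=
  HB.pack f (GRing.isLinear.Build R 'rV[R]_n X _ f flin).
have Fcont : continuous F by exact: lincomb_continuous.
have Finj : injective F.
  have bfree : free b := basis_free (vbasisP {:X}).
  move=> u v /= uv; apply/rowP => i.
  by rewrite -(coord_sum_free (u ord0) i bfree)
    -(coord_sum_free (v ord0) i bfree) [X in coord _ _ X]uv.
have [c c0 Fc] := linear_inj_bounded_below _ _ _ F Fcont Finj.
have -> : unit_sphere X = F @` (F @^-1` unit_sphere X).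
  apply/seteqP; split => [x x1|_ [v ? <-]]//.
  have Fx : F (\row_i coord b i x) = x.
    rewrite [RHS](coord_vbasis (memvf x)); apply: eq_bigr => i _.
    by rewrite mxE.
  by exists (\row_i coord b i x) => //; rewrite /preimage /mkset Fx.
apply: continuous_compact; first exact: continuous_subspaceT.
apply: bounded_closed_compact.
  exists c^-1; split; first by rewrite num_real.
  move=> M cM v /= Fv1; apply: le_trans (ltW cM).
  by rewrite -[c^-1]mulr1 ler_pdivlMl// -Fv1; exact: Fc.
apply: (@preimage_closed _ _ (fun v => `|F v|) [set x : R | x = 1]);
  last exact: closed_eq.
by move=> v _; apply: (@cvg_norm _ _ _ (nbhs v)); exact: Fcont.
Qed.

(** * The supremum is attained *)

(** Orthogonality is the intersection over [t] of the closed conditions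
    [0 <= `|x + t *: y| - `|x|]. *)
Lemma closed_BJ_orthogonal (R : realType) (X : normedModType R) :
  closed [set p : X * X | BJ_orthogonal p.1 p.2].
Proof.
have -> : [set p : X * X | BJ_orthogonal p.1 p.2] =
    \bigcap_(t in [set: R]) [set p | 0 <= `|p.1 + t *: p.2| - `|p.1|].
  apply/seteqP; split => [p pBJ t _|p pBJ t] /=.
    by rewrite subr_ge0; exact: pBJ.
  by rewrite -subr_ge0; exact: pBJ.
apply: closed_bigI => t _.
apply: (@preimage_closed _ _ (fun p : X * X => `|p.1 + t *: p.2| - `|p.1|)
  [set x : R | 0 <= x]); last exact: closed_ge.
move=> p _; apply: cvgB; apply: cvg_norm; last exact: cvg_fst.
by apply: cvgD; [exact: cvg_fst|apply: cvgZl_tmp; exact: cvg_snd].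
Qed.

(** A nonzero value of [J_perp] is needed because [sup] is 0 on the empty set,
    as happens in dimension at most 1. *)
Lemma J_perp_attained (R : realType) (X : finDimBanachType R) (lambda : R) :
  J_perp X lambda != 0 ->
  exists x y : X, [/\ unit_sphere X x, unit_sphere X y, BJ_orthogonal x y &
    J_perp X lambda = Num.min `|lambda *: x + (1 - lambda) *: y|
                              `|lambda *: x - (1 - lambda) *: y|].
Proof.
move=> J0.
pose m (p : X * X) := Num.min `|lambda *: p.1 + (1 - lambda) *: p.2|
                              `|lambda *: p.1 - (1 - lambda) *: p.2|.
pose K := (unit_sphere X `*` unit_sphere X) `&`
  [set p | BJ_orthogonal p.1 p.2].
have cK : compact K.
  have cSS := compact_setX (compact_unit_sphere _ X) (compact_unit_sphere _ X).
  apply: subclosed_compact cSS _; last by move=> p [].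
  apply: closedI; last exact: closed_BJ_orthogonal.
  have nclosed (g : X * X -> X) : continuous g -> closed [set p | `|g p| = 1].
    move=> gcont; apply: (@preimage_closed _ _ (fun p => `|g p|)
      [set x : R | x = 1]); last exact: closed_eq.
    by move=> p _; apply: cvg_norm; exact: gcont.
  by apply: closedI; apply: nclosed => p; [exact: cvg_fst|exact: cvg_snd].
have mcont : continuous m.
  pose a (p : X * X) := `|lambda *: p.1 + (1 - lambda) *: p.2|.
  pose b (p : X * X) := `|lambda *: p.1 - (1 - lambda) *: p.2|.
  move=> p; apply: (@continuous_min R _ a b p); apply: cvg_norm;
    [apply: cvgD|apply: cvgB]; apply: cvgZl_tmp;
    by [exact: cvg_fst|exact: cvg_snd].
have [[r0 [x0 [y0 [x01 y01 xy0 _]]]]|E0] := pselect ([set r | exists x y : X,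
    [/\ unit_sphere X x, unit_sphere X y, BJ_orthogonal x y &
        r = m (x, y)]] !=set0); last first.
  move/eqP: J0; case; apply: sup_out => -[/= Ene _]; exact: E0.
have K0 : K !=set0 by exists (x0, y0).
have [[x y] /set_mem [[/= x1 y1] xy] mmax] :=
  compact_EVT_max K0 cK (continuous_subspaceT mcont).
exists x, y; split => //.
apply/le_anti/andP; split.
  apply: ge_sup; first by exists (m (x0, y0)), x0, y0.
  by move=> _ [u [v [u1 v1 uv ->]]]; apply: (mmax (u, v)); rewrite inE.
apply: ub_le_sup; last by exists x, y.
exists (m (x, y)) => _ [u [v [u1 v1 uv ->]]].
by apply: (mmax (u, v)); rewrite inE.
Qed.

(** * Segments in the sphere *)

Lemma BJ_orthogonal_neq (R : realType) (X : normedModType R) (x y : X) :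
  unit_sphere X x -> BJ_orthogonal x y -> x <> y.
Proof.
move=> x1 xy exy; have := xy (-1).
by rewrite -exy scaleN1r subrr normr0 x1 ler10.
Qed.

Lemma ler_norm_conv (R : realType) (X : normedModType R) (x y : X) (t : R) :
  `|x| <= 1 -> `|y| <= 1 -> 0 <= t <= 1 -> `|t *: x + (1 - t) *: y| <= 1.
Proof.
move=> x1 y1 /andP[t0 t1]; apply: (le_trans (ler_normD _ _)).
rewrite !normrZ !ger0_norm ?subr_ge0//.
rewrite -[leRHS](subrKC t); apply: lerD; first exact: ler_piMr.
by apply: ler_piMr => //; rewrite subr_ge0.
Qed.

(** A point [z] of the segment lies on one side of the interior point [w] where
    the norm is 1, so [w] is a convex combination, with nonzero weight on [z],
    of [z] and the endpoint on the other side; if [z] had norm less than 1, so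
    would [w]. *)
Lemma segment_in_sphere (R : realType) (X : normedModType R) (x y : X)
    (lambda : R) :
  unit_sphere X x -> unit_sphere X y -> 0 < lambda -> lambda < 1 ->
  1 <= `|lambda *: x + (1 - lambda) *: y| ->
  line_segment x y `<=` unit_sphere X.
Proof.
(* It suffices to treat the side of the first endpoint: the other one follows
   by exchanging [x] with [y] and [lambda] with [1 - lambda]. *)
have side (u v : X) (l t : R) : `|v| <= 1 -> 0 < l -> l <= t ->
    1 <= `|l *: u + (1 - l) *: v| -> 1 <= `|t *: u + (1 - t) *: v|.
  move=> v1 l0 lt w1.
  have t0 : 0 < t := lt_le_trans l0 lt.
  have lt0 : 0 < l / t by rewrite divr_gt0.
  have lt1 : l / t <= 1 by rewrite ler_pdivrMr// mul1r.
  have wE : l *: u + (1 - l) *: v =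
      (l / t) *: (t *: u + (1 - t) *: v) + (1 - l / t) *: v.
    rewrite scalerDr !scalerA divfK ?gt_eqF// -addrA -scalerDl.
    congr (_ + _ *: _).
    by rewrite mulrBr mulr1 divfK ?gt_eqF// [RHS]addrC addrA subrK.
  move: (l / t) lt0 lt1 wE => r r0 r1 wE.
  have : 1 <= r * `|t *: u + (1 - t) *: v| + (1 - r).
    rewrite wE in w1; apply: (le_trans w1); apply: (le_trans (ler_normD _ _)).
    rewrite !normrZ !ger0_norm ?subr_ge0 ?(ltW r0)//.
    by rewrite lerD2l; apply: ler_piMr; rewrite ?subr_ge0.
  by rewrite addrCA lerDl subr_ge0 ler_pMr.
move=> x1 y1 l0 l1 w1 _ [t /andP[t0 t1] <-]; apply/le_anti/andP; split.
  by apply: ler_norm_conv; rewrite ?x1 ?y1 ?t0.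
have [lt|/ltW tl] := leP lambda t.
  by apply: (side x y lambda) => //; rewrite y1.
rewrite addrC -[X in X *: x](subKr 1); apply: (side y x (1 - lambda)).
- by rewrite x1.
- by rewrite subr_gt0.
- by rewrite lerD2l lerN2.
- by rewrite addrC subKr.
Qed.

Theorem proposition3p12 (R : realType) (X : finDimBanachType R) (lambda : R) :
  (2 <= \dim {:X})%N -> 0 < lambda -> lambda < 1 ->
  J_perp X lambda = 1 ->
  (exists2 A : set X, nontrivial_line_segment A & A `<=` unit_sphere X) /\
  ~ strictly_convex X.
Proof.
move=> _ l0 l1 J1.
have [|x [y [x1 y1 xy]]] := @J_perp_attained R X lambda.
  by rewrite J1 oner_eq0.
rewrite J1 => m1.
have w1 : 1 <= `|lambda *: x + (1 - lambda) *: y|.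
  by rewrite [leLHS]m1 ge_min lexx.
have nxy := BJ_orthogonal_neq _ _ _ _ x1 xy.
have segS := segment_in_sphere _ _ _ _ _ x1 y1 l0 l1 w1.
split; first by exists (line_segment x y) => //; exists x, y.
move=> /(_ _ _ x1 y1 nxy); rewrite ltNge => /negP; apply.
rewrite -[leLHS](segS (2^-1 *: (x + y)))//; exists 2^-1.
  by rewrite /= invr_ge0 ler0n/= invf_le1// ler1n.
rewrite scalerDr; congr (_ + _ *: _).
by rewrite {1}(splitr 1) div1r addrK.
Qed.
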